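(* $Z(\ell_\infty)$ is not spaceable in $\ell_\infty$; that is, there is no infinite dimensional closed linear subspace $Y$ of $\ell_\infty$ with $Y\subset Z(\ell_\infty)\cup\{0\}$.
   Context: All sequence spaces are over $\mathbb{C}$. $Z(\ell_\infty)$ denotes the set of all sequences in $\ell_\infty$ having only finitely many zero coordinates. A subset $M$ of a topological vector space $X$ is spaceable in $X$ if there is an infinite dimensional closed linear subspace $Y$ of $X$ with $Y\subset M\cup\{0\}$. *)

(* Defs.v *)
From HB Require Import structures.
From mathcomp Require Import all_boot all_order all_algebra.
From mathcomp Require Import complex.
From mathcomp Require Import all_classical all_reals all_analysis.

Set Implicit Arguments.
Unset Strict Implicit.
Unset Printing Implicit Defensive.

Import Order.TTheory GRing.Theory Num.Theory.
Import numFieldNormedType.Exports.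
Import Normc.

Local Open Scope classical_set_scope.
Local Open Scope ring_scope.
Local Open Scope complex_scope.

Definition finite_dimensional (K : numFieldType) (X : lmodType K)
    (Y : set X) : Prop :=
  exists (n : nat) (e : 'I_n -> X),
    Y = [set \sum_(i < n) a i *: e i | a in [set: 'I_n -> K]].

(* [topologicalLmodType K] is the class of topological vector spaces;
   the library's [tvsType K] requires in addition local convexity. *)
Definition spaceable (K : numFieldType) (X : topologicalLmodType K)
    (M : set X) : Prop :=
  exists Y : set X,
    [/\ GRing.submod_closed (mem Y), closed Y, ~ finite_dimensional Y &
        Y `<=` M `|` [set 0]].

Section linfty.
Variable R : realType.

Lemma normcE (z : R[i]) : `|z| = (normc z)%:C. Proof. by []. Qed.

Lemma normc_ge0 (z : R[i]) : 0 <= normc z.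
Proof. by rewrite -ler0c -normcE. Qed.

Lemma ler_normcD (z w : R[i]) : normc (z + w) <= normc z + normc w.
Proof. by rewrite -lecR rmorphD/= -!normcE ler_normD. Qed.

Definition bounded_seq : {pred nat -> R[i]} :=
  [pred x | `[< exists M : R, forall n, normc (x n) <= M >]].

Lemma bounded_seqP (x : nat -> R[i]) :
  reflect (exists M : R, forall n, normc (x n) <= M) (x \in bounded_seq).
Proof. exact: asboolP. Qed.

Lemma bounded_seq_submod : GRing.submod_closed bounded_seq.
Proof.
split=> [|a x y /bounded_seqP[M xM] /bounded_seqP[N yN]].
  by apply/bounded_seqP; exists 0 => n; rewrite normc0.
apply/bounded_seqP; exists (normc a * M + N) => n.
rewrite (le_trans (ler_normcD _ _))// lerD// normcM.
by rewrite ler_wpM2l ?normc_ge0.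
Qed.

HB.instance Definition _ :=
  GRing.isSubmodClosed.Build R[i] (nat -> R[i]) bounded_seq bounded_seq_submod.

Record linfty := Linfty {
  linfty_val :> nat -> R[i];
  linfty_valP : linfty_val \in bounded_seq }.

HB.instance Definition _ := [isSub for linfty_val].
HB.instance Definition _ := [Choice of linfty by <:].
HB.instance Definition _ := [SubChoice_isSubLmodule of linfty by <:].

Lemma linftyDE (x y : linfty) n : (x + y) n = x n + y n.
Proof. by []. Qed.

Lemma linftyZE (a : R[i]) (x : linfty) n : (a *: x) n = a * x n.
Proof. by []. Qed.

Definition linfty_norm (x : linfty) : R := sup (range (fun n => normc (x n))).

Lemma linfty_norm_ub (x : linfty) n : normc (x n) <= linfty_norm x.
Proof.
apply: ub_le_sup; last by exists n.
by have /bounded_seqP[M xM] := linfty_valP x; exists M => _ [k _ <-].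
Qed.

Lemma linfty_norm_le (x : linfty) (M : R) :
  (forall n, normc (x n) <= M) -> linfty_norm x <= M.
Proof.
move=> xM; apply: ge_sup; first by exists (normc (x 0%N)); exists 0%N.
by move=> _ [n _ <-].
Qed.

Let norm (x : linfty) : R[i] := (linfty_norm x)%:C.

Let ler_normD (x y : linfty) : norm (x + y) <= norm x + norm y.
Proof.
rewrite -rmorphD lecR; apply: linfty_norm_le => n.
by rewrite (le_trans (ler_normcD _ _))// lerD ?linfty_norm_ub.
Qed.

Let linfty_normZ_le (a : R[i]) (x : linfty) :
  linfty_norm (a *: x) <= normc a * linfty_norm x.
Proof.
apply: linfty_norm_le => n.
by rewrite linftyZE normcM ler_wpM2l ?normc_ge0 ?linfty_norm_ub.
Qed.

Let normrZ (a : R[i]) (x : linfty) : norm (a *: x) = `|a| * norm x.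
Proof.
rewrite normcE -rmorphM; congr (_%:C); apply/le_anti/andP; split=> //.
have [->|a0] := eqVneq a 0.
  rewrite normc0 mul0r (le_trans (normc_ge0 ((0 *: x : linfty) 0%N)))//.
  exact: linfty_norm_ub.
have ca0 : 0 < normc a.
  by rewrite lt_def normc_ge0 andbT; apply: contra a0 => /eqP/eq0_normc ->.
rewrite -ler_pdivlMl// -normcV (le_trans _ (linfty_normZ_le _ _))//.
by rewrite scalerA mulVf// scale1r.
Qed.

Let normr0_eq0 (x : linfty) : norm x = 0 -> x = 0.
Proof.
move=> /complexI x0; apply/val_inj/funext => n; apply: eq0_normc.
by apply/le_anti; rewrite normc_ge0 -x0 linfty_norm_ub.
Qed.

(* Norms of modules over R[i] take values in R[i]; this factory also derives
   the topology of [linfty] from the norm. *)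
HB.instance Definition _ :=
  Lmodule_isNormed.Build R[i] linfty ler_normD normrZ normr0_eq0.

Lemma linfty_normE (x : linfty) : `|x| = (linfty_norm x)%:C.
Proof. by []. Qed.

Definition Z_linfty : set linfty := [set x | finite_set [set n | x n = 0]].

End linfty.

Arguments Z_linfty R _ : clear implicits.

(* Main.v *)
Require Import Defs.
From mathcomp Require Import all_boot all_order all_algebra complex.
From mathcomp Require Import all_classical all_reals all_analysis.
From mathcomp Require Import ring lra.

Set Implicit Arguments.
Unset Strict Implicit.
Unset Printing Implicit Defensive.

Import Order.TTheory GRing.Theory Num.Theory.
Import numFieldNormedType.Exports.
Import Normc.

Local Open Scope classical_set_scope.
Local Open Scope ring_scope.
Local Open Scope complex_scope.

(** Let [Y] be a closed infinite-dimensional subspace of l^oo. A nonzero element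
    of [Y] with infinitely many zeros is built by a gliding hump argument.

    Since finitely many linear conditions cannot exhaust [Y], for every [m] there
    is [y_m] in [Y] vanishing below [m] and, up to a factor 2, attaining its norm
    at some [p_m >= m] ([infinite_dimensional_hump]). Starting from one element
    [s_0], one would like to add smaller and smaller multiples of later and later
    humps, each addition creating a zero at the peak of the hump it uses and
    leaving all earlier coordinates alone. The multiple needed to create a zero of
    [s] at a peak [q] is of size [|s q|], so the process converges only if the
    partial sums are small at far away peaks.

    To ensure this, fix a free ultrafilter [F] on the indices and use only
    elements [s] with [s (p_k) --> 0] along [F]. These form the kernel in [Y] of
    one linear functional, the limit along [F] of the values at the peaks. Hence
    two humps [y_i], [y_j], with [j] beyond the peak of [y_i], have a combination
    in this kernel, and the ratio of the two limit values decides which of the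
    two to rescale so that a definite peak survives at [p_i] or at [p_j]
    ([null_hump]). Both [i] and [j] can be taken in any prescribed member of [F],
    in particular in the set of [k] such that [s (p_k)] is tiny. This gives the
    inductive step ([null_correction]): [s] is changed by at most [e] in norm, not
    at all below [M], acquires a zero beyond [M], and remains null at the peaks.

    Iterating with [e = 2^-r], the iterates converge in norm and stabilise at each
    coordinate ([linfty_gluing]). The limit lies in [Y], it keeps every zero
    created on the way, and it is not [0] since it agrees with [s_0] at a
    coordinate where [s_0] does not vanish. *)

(** * Finite dimension and a hyperplane *)

(** A hyperplane section of [Y] lacks at most one dimension: if [f y0 != 0], then
    [x - (f x / f y0) y0] lies in the kernel of [f] for every [x] in [Y]. *)
Lemma finite_dimensional_kernel (K : numFieldType) (X : lmodType K)
    (Y : set X) (f : X -> K) :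
  GRing.submod_closed (mem Y) ->
  (forall a x y, f (a *: x + y) = a * f x + f y) ->
  finite_dimensional (Y `&` [set x | f x = 0]) -> finite_dimensional Y.
Proof.
move=> [_ Ylin] flin [n [e eE]].
have {}Ylin a x y : Y x -> Y y -> Y (a *: x + y).
  by move=> Yx Yy; apply/set_mem/Ylin; apply/mem_set.
have [[y0 Yy0 fy0]|f0] := pselect (exists2 y, Y y & f y != 0); last first.
  exists n, e; rewrite -eE; apply/seteqP; split=> [x Yx|x []//]; split=> //.
  by apply/eqP/negPn/negP => fx; apply: f0; exists x.
exists n.+1, (fun i => oapp e y0 (unlift ord0 i)).
have sumE (a : 'I_n.+1 -> K) : \sum_(i < n.+1) a i *: oapp e y0 (unlift ord0 i) =
    a ord0 *: y0 + \sum_(i < n) a (lift ord0 i) *: e i.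
  rewrite big_ord_recl unlift_none; congr (_ + _).
  by apply: eq_bigr => i _; rewrite liftK.
apply/seteqP; split=> [x Yx|_ [a _ <-]].
  have : (Y `&` [set x | f x = 0]) (- (f x / f y0) *: y0 + x).
    by split; [exact: Ylin|rewrite /= flin mulNr divfK// addNr].
  rewrite eE => -[a _ ax].
  exists (fun i => oapp a (f x / f y0) (unlift ord0 i)) => //.
  rewrite sumE unlift_none.
  under eq_bigr do rewrite liftK.
  by rewrite /= ax scaleNr addNKr.
rewrite sumE; apply: Ylin => //.
have : (Y `&` [set x | f x = 0]) (\sum_(i < n) a (lift ord0 i) *: e i).
  by rewrite eE; exists (fun i => a (lift ord0 i)).
by case.
Qed.

(** * Limits of bounded sequences along an ultrafilter *)

(** The image of [F] under [u] is an ultrafilter containing a compact segment. *)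
Lemma bounded_ultra_cvg (R : realType) (F : set_system nat) (u : nat -> R)
    (M : R) :
  UltraFilter F -> (forall n, `|u n| <= M) -> exists a : R, u @ F --> a.
Proof.
move=> UF uM.
have UuF : UltraFilter (u @ F).
  split; first exact: fmap_proper_filter.
  move=> G PG sG; apply/seteqP; split=> // A GA.
  have [//|FA] := in_ultra_setVsetC (u @^-1` A) UF.
  have : G (A `&` ~` A) by apply: filterI => //; apply: sG.
  by rewrite setICr => /filter_not_empty.
have : (u @ F) `[- M, M]%classic.
  by apply: nearW => n /=; rewrite in_itv/= -ler_norml.
have := @segment_compact R (- M) M.
rewrite compact_ultra => /(_ _ UuF) /[apply].
by move=> [a [_ ?]]; exists a.
Qed.

(** The real and imaginary parts converge separately. Convergence is phrased with
    the real number [normc (u k - a)], in which all later estimates are made. *)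
Lemma bounded_ultra_cvgC (R : realType) (F : set_system nat)
    (u : nat -> R[i]) (M : R) : UltraFilter F ->
  (forall n, normc (u n) <= M) -> exists a, normc (u k - a) @[k --> F] --> 0.
Proof.
move=> UF uM.
have sqrt_le (x y : R) : `|x| <= Num.sqrt (x ^+ 2 + y ^+ 2).
  by rewrite -sqrtr_sqr ler_wsqrtr// lerDl sqr_ge0.
have [|a ua] := @bounded_ultra_cvg R F (fun k => complex.Re (u k)) M UF.
  by move=> n; rewrite (le_trans _ (uM n))//; case: (u n) => x y /=.
have [|b ub] := @bounded_ultra_cvg R F (fun k => complex.Im (u k)) M UF.
  move=> n; rewrite (le_trans _ (uM n))//; case: (u n) => x y /=.
  by rewrite addrC.
exists (a +i* b).
have -> : 0 = Num.sqrt ((a - a) ^+ 2 + (b - b) ^+ 2) :> R.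
  by rewrite !subrr expr0n/= addr0 sqrtr0.
rewrite (_ : (fun k => _) =
    (fun k => Num.sqrt ((complex.Re (u k) - a) ^+ 2 + (complex.Im (u k) - b) ^+ 2))).
  have PF : ProperFilter F by exact: ultra_proper.
  apply: continuous_cvg; first exact: sqrt_continuous.
  rewrite !expr2.
  apply: cvgD; apply: cvgM; apply: cvgB => //; exact: cvg_cst.
by apply/funext => k; case: (u k).
Qed.

Lemma normc_cvg0_lin (R : realType) (F : set_system nat) (u v : nat -> R[i])
    (c : R[i]) : Filter F ->
  normc (u k) @[k --> F] --> 0 -> normc (v k) @[k --> F] --> 0 ->
  normc (c * u k + v k) @[k --> F] --> 0.
Proof.
move=> FF u0 v0.
apply: (@squeeze_cvgr _ _ _ _ (fun=> 0)
  (fun k => normc c * normc (u k) + normc (v k))); last 2 first.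
- exact: cvg_cst.
- rewrite -[X in _ --> X]addr0 -[X in X + _](mulr0 (normc c)).
  by apply: cvgD => //; apply: cvgM => //; exact: cvg_cst.
by apply: nearW => k; rewrite normc_ge0 -normcM ler_normcD.
Qed.

(** * Humps in an infinite-dimensional subspace *)

(** The supremum norm need not be attained, hence the factor 2. *)
Lemma linfty_peak (R : realType) (y : linfty R) : y <> 0 ->
  exists2 p, y p != 0 & forall n, normc (y n) <= 2 * normc (y p).
Proof.
move=> y0; have N0 : 0 < linfty_norm y.
  have : `|y| != 0 by rewrite normr_eq0; exact/eqP.
  by rewrite -normr_gt0 normr_id linfty_normE ltcR.
have [p yp] : exists p, linfty_norm y / 2 < normc (y p).
  apply/not_existsP => h.
  have : linfty_norm y <= linfty_norm y / 2.
    by apply: linfty_norm_le => n; rewrite leNgt; exact/negP/h.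
  by lra.
exists p => [|n]; last by have := linfty_norm_ub y n; lra.
by apply/eqP => yp0; move: yp; rewrite {}yp0 normc0; lra.
Qed.

(** A hump starts no earlier than [m] and is normalised at its peak [p], so the
    bound 2 says that [y] attains its norm at [p] up to a factor 2. *)
Definition hump (R : realType) (Y : set (linfty R)) (m : nat) (y : linfty R)
    (p : nat) : Prop :=
  [/\ Y y, (m <= p)%N, y p = 1, forall n, normc (y n) <= 2 &
      forall i, (i < m)%N -> y i = 0].

Section infinite_dimensional_subspace.
Variables (R : realType) (Y : set (linfty R)).
Hypothesis Ysub : GRing.submod_closed (mem Y).
Hypothesis Yinf : ~ finite_dimensional Y.

Let Ylin (a : R[i]) (x y : linfty R) : Y x -> Y y -> Y (a *: x + y).
Proof. by move=> Yx Yy; apply/set_mem/(proj2 Ysub); apply/mem_set. Qed.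

Let Y0 : Y 0.
Proof. exact/set_mem/(proj1 Ysub). Qed.

(** The elements of [Y] vanishing below [m] form the intersection of [Y] with [m]
    successive hyperplanes, so they still span infinitely many dimensions. *)
Lemma infinite_dimensional_tail (m : nat) : exists y : linfty R,
  [/\ Y y, y <> 0 & forall i, (i < m)%N -> y i = 0].
Proof.
pose tail m := Y `&` [set y : linfty R | forall i, (i < m)%N -> y i = 0].
have tail_sub k : GRing.submod_closed (mem (tail k)).
  split=> [|a x y /set_mem[Yx x0] /set_mem[Yy y0]]; apply/mem_set; split=> //.
    exact: Ylin.
  by move=> i ik; rewrite linftyDE linftyZE x0// y0// mulr0 addr0.
have tail_inf : ~ finite_dimensional (tail m).
  elim: m => [|k IH].
    by rewrite (_ : tail 0 = Y)//; apply/seteqP; split=> [x []|x Yx].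
  move=> fin; apply: IH.
  apply: (@finite_dimensional_kernel _ _ _ (fun x : linfty R => x k)) => //.
  rewrite (_ : _ `&` _ = tail k.+1)//; apply/seteqP; split=> [x [[Yx x0] xk]|x].
    by split=> // i; rewrite ltnS leq_eqVlt => /predU1P[->//|/x0].
  by move=> [Yx x0]; split; [split=> // i ik|]; apply: x0 => //; exact: ltnW.
apply/not_existsP => h; apply: tail_inf; exists 0, (fun=> 0).
apply/seteqP; split=> [x [Yx x0]|_ [a _ <-]]; last first.
  by rewrite big_ord0; split=> [|i _]; first exact: Y0.
have [->|/eqP nx0] := eqVneq x 0.
  by exists (fun=> 0) => //; rewrite big_ord0.
by exfalso; apply: (h x).
Qed.

Lemma infinite_dimensional_hump (m : nat) :
  exists (y : linfty R) (p : nat), hump Y m y p.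
Proof.
have [y [Yy y0 ym]] := infinite_dimensional_tail m.
have [p yp ymax] := linfty_peak y0.
exists ((y p)^-1 *: y), p; split.
- by rewrite -[_ *: _]addr0; apply: Ylin.
- by rewrite leqNgt; apply: contra yp => /ym ->.
- by rewrite linftyZE mulVf.
- move=> n; rewrite linftyZE normcM normcV ler_pdivrMl 1?mulrC//.
  by rewrite lt_def normc_ge0 andbT; apply: contra yp => /eqP/eq0_normc ->.
- by move=> i im; rewrite linftyZE (ym i)// mulr0.
Qed.

End infinite_dimensional_subspace.

(** * The gliding hump along an ultrafilter *)

Section gliding_hump.
Variables (R : realType) (Y : set (linfty R)).
Hypothesis Ysub : GRing.submod_closed (mem Y).
Variables (y : nat -> linfty R) (p : nat -> nat).
Hypothesis yP : forall m, hump Y m (y m) (p m).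
Variable F : set_system nat.
Hypothesis UF : UltraFilter F.
Hypothesis Foo : \oo `<=` F.

Let Ylin (a : R[i]) (x z : linfty R) : Y x -> Y z -> Y (a *: x + z).
Proof. by move=> Yx Yz; apply/set_mem/(proj2 Ysub); apply/mem_set. Qed.

Let PF : ProperFilter F. Proof. exact: ultra_proper. Qed.

Let Yy m : Y (y m). Proof. by have [] := yP m. Qed.

Let le_p m : (m <= p m)%N. Proof. by have [] := yP m. Qed.

Let y_peak m : y m (p m) = 1. Proof. by have [] := yP m. Qed.

Let y_bound m n : normc (y m n) <= 2. Proof. by have [] := yP m. Qed.

Let y_tail m i : (i < m)%N -> y m i = 0.
Proof. by have [_ _ _ _] := yP m; apply. Qed.

Definition null (s : linfty R) := normc (s (p k)) @[k --> F] --> 0.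

Lemma nullD (a : R[i]) (s t : linfty R) :
  null s -> null t -> null (a *: s + t).
Proof. exact: normc_cvg0_lin. Qed.

(** Let [a] and [b] be the limits along [F] of the values of [y i] and [y j] at the
    peaks. Both [y j - (b / a) y i] and [y i - (a / b) y j] have limit [0]. The
    second has value [1] at [p i], where [y j] vanishes, but its norm is controlled
    only if [a / b] is bounded. If instead [|b| <= |a| / 4], the first one has at
    [p j] a value at least [1 - 2 / 4], since [|y i| <= 2] everywhere. The
    constant 10 is [4 * 2 + 2]. *)
Lemma null_hump (A : set nat) (M : nat) : F A -> exists z k,
  [/\ Y z, null z, forall i, (i < M)%N -> z i = 0 & A k /\ (M <= p k)%N] /\
  (2^-1 <= normc (z (p k))) /\ (forall n, normc (z n) <= 10).
Proof.
move=> FA.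
have far N : exists2 k, A k & (N <= k)%N.
  have /filter_ex[k [Ak Nk]] : F (A `&` [set k | (N <= k)%N]).
    by apply: filterI => //; apply: Foo; exact: nbhs_infty_ge.
  by exists k.
have [i Ai Mi] := far M; have [j Aj ij] := far (p i).+1.
have [a ya] := bounded_ultra_cvgC UF (fun k => y_bound i (p k)).
have [b yb] := bounded_ultra_cvgC UF (fun k => y_bound j (p k)).
have i_le_j : (i <= j)%N by rewrite (leq_trans (le_p i))// ltnW.
(* With division by zero returning 0, the combination degenerates to [t] when
   [c = 0], which is right provided that [d = 0] as well. *)
have null_comb (s t : linfty R) (c d : R[i]) :
    normc (s (p k) - c) @[k --> F] --> 0 ->
    normc (t (p k) - d) @[k --> F] --> 0 ->
    (c = 0 -> d = 0) -> null (- (d / c) *: s + t).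
  move=> sc td cd; rewrite /null (_ : (fun k => normc _) = (fun k =>
    normc (- (d / c) * (s (p k) - c) + (t (p k) - d)))).
    exact: normc_cvg0_lin.
  apply/funext => k; congr normc.
  have [c0|c0] := eqVneq c 0.
    by rewrite c0 cd// mul0r oppr0 scale0r mul0r !add0r addr0.
  by rewrite linftyDE linftyZE; field.
have comb_tail (s t : linfty R) c :
    (forall i, (i < M)%N -> s i = 0) -> (forall i, (i < M)%N -> t i = 0) ->
    forall i, (i < M)%N -> (c *: s + t) i = 0.
  by move=> s0 t0 l lM; rewrite linftyDE linftyZE s0// t0// mulr0 addr0.
have yi0 l : (l < M)%N -> y i l = 0.
  by move=> lM; apply: y_tail; rewrite (leq_trans lM).
have yj0 l : (l < M)%N -> y j l = 0.
  by move=> lM; apply: y_tail; rewrite (leq_trans lM)// (leq_trans Mi).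
have comb_le (s t : linfty R) (c : R[i]) : normc c <= 4 ->
    (forall n, normc (s n) <= 2) -> (forall n, normc (t n) <= 2) ->
    forall n, normc ((c *: s + t) n) <= 10.
  move=> c4 s2 t2 n; rewrite linftyDE linftyZE (le_trans (ler_normcD _ _))//.
  rewrite normcM (_ : 10 = 4 * 2 + 2); last by lra.
  by rewrite lerD// ler_pM// ?normc_ge0.
have normc_div (c d : R[i]) (e : R) : 0 <= e -> normc c <= e * normc d ->
    normc (- (c / d)) <= e.
  move=> e0 cd; rewrite (normcN (_ : Rcomplex R)) normcM normcV.
  have [d0|d0] := eqVneq (normc d) 0; first by rewrite d0 invr0 mulr0.
  by rewrite ler_pdivrMr// lt_def d0 normc_ge0.
have [ab|ab] := leP (normc b) (4^-1 * normc a).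
- exists (- (b / a) *: y i + y j), j; split; split.
  + exact: Ylin.
  + apply: null_comb => // a0; move: ab; rewrite a0 normc0 mulr0 => b0.
    by apply: eq0_normc; apply/le_anti; rewrite b0 normc_ge0.
  + exact: comb_tail.
  + by split=> //; rewrite (leq_trans Mi)// (leq_trans i_le_j).
  + have t4 : normc (- (b / a)) <= 4^-1 by apply: normc_div => //; lra.
    have : normc (- (b / a) * y i (p j)) <= 4^-1 * 2.
      by rewrite normcM ler_pM ?normc_ge0.
    rewrite linftyDE linftyZE y_peak; move: (_ * y i _) => w w2.
    have := ler_normcD (w + 1) (- w).
    rewrite (normcN (w : Rcomplex R)) addrAC subrr add0r normc1; lra.
  + apply: comb_le => //; apply: normc_div; first by lra.
    by have := normc_ge0 a; lra.
- exists (- (a / b) *: y j + y i), i; split; split.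
  + exact: Ylin.
  + apply: null_comb => // b0; move: ab; rewrite {}b0 normc0.
    by rewrite ltNge mulr_ge0 ?normc_ge0.
  + exact: comb_tail.
  + by split=> //; rewrite (leq_trans Mi).
  + by rewrite linftyDE linftyZE y_tail// y_peak mulr0 add0r normc1; lra.
  + apply: comb_le => //; apply: normc_div; first by lra.
    by have := normc_ge0 a; lra.
Qed.

(** The multiple of the hump [z] that cancels [s] at the peak [q] of [z] has
    coefficient at most [2 |s q|], hence norm at most [20 |s q|]; so the peak
    is sought among those where [|s q| < e / 20]. *)
Lemma null_correction (s : linfty R) (M : nat) (e : R) : 0 < e ->
  Y s -> null s -> exists s' q,
  [/\ Y s', null s', s' q = 0, (M <= q)%N & forall i, (i < M)%N -> s' i = s i] /\
  forall n, normc (s' n - s n) <= e.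
Proof.
move=> e0 Ys s0.
have FA : F [set k | normc (s (p k)) < e / 20].
  have /cvgrPdist_lt/(_ (e / 20)) := s0.
  have -> : 0 < e / 20 by lra.
  move=> /(_ isT); apply: filterS => k /=.
  by rewrite sub0r normrN ger0_norm ?normc_ge0.
have [z [k [[Yz z0 zM [/= sk Mk]] [zk z10]]]] := null_hump M FA.
have zk0 : z (p k) != 0 by apply/eqP => z_0; move: zk; rewrite {}z_0 normc0; lra.
exists (- (s (p k) / z (p k)) *: z + s), (p k); split; first split=> //.
- exact: Ylin.
- exact: nullD.
- by rewrite linftyDE linftyZE mulNr divfK// addNr.
- by move=> i iM; rewrite linftyDE linftyZE (zM i)// mulr0 add0r.
move=> n; rewrite linftyDE linftyZE addrK mulNr (normcN (_ : Rcomplex R)).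
rewrite !normcM normcV mulrAC ler_pdivrMr; last by lra.
have : normc (s (p k)) * normc (z n) <= e / 20 * 10.
  by rewrite ler_pM ?normc_ge0// ltW.
have : e * 2^-1 <= e * normc (z (p k)) by rewrite ler_pM2l.
lra.
Qed.

End gliding_hump.

(** * Passing to the limit *)

Lemma closed_uniform_approx (R : realType) (Y : set (linfty R))
    (x : linfty R) : closed Y ->
  (forall e : R, 0 < e ->
    exists2 s, Y s & forall n, normc (x n - s n) <= e) -> Y x.
Proof.
move=> /closure_id YE xY; rewrite YE => B /nbhs_ballP[e/= e0 xB].
(* Radii of balls are elements of [R[i]]; being positive forces them to be real. *)
have [r r0 re] : exists2 r : R, 0 < r & r%:C < e.
  exists (complex.Re e / 2); move: e0 {xB}; case: e => a b /=; rewrite !ltcE/=.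
    by move=> /andP[_]; lra.
  by move=> /andP[/eqP -> a0]; rewrite eqxx/=; lra.
have [s Ys xs] := xY r r0.
exists s; split=> //; apply: xB; rewrite -ball_normE/=.
by rewrite (le_lt_trans _ re)// linfty_normE lecR; exact: linfty_norm_le.
Qed.

(** Coordinate [n] is constant from index [n.+1] on, because [r <= M r]. This
    defines the limit outright, and the geometric bounds on the increments show
    that it is bounded and that the convergence is uniform. *)
Lemma linfty_gluing (R : realType) (s : nat -> linfty R) (M : nat -> nat) :
  (forall r, (M r < M r.+1)%N) ->
  (forall r i, (i < M r)%N -> s r.+1 i = s r i) ->
  (forall r n, normc (s r.+1 n - s r n) <= 2^-1 ^+ r) ->
  exists x : linfty R,
    (forall r i, (i < M r)%N -> x i = s r i) /\
    (forall r n, normc (x n - s r n) <= 2 * 2^-1 ^+ r).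
Proof.
move=> Minc sM sdist.
have le_M r : (r <= M r)%N.
  by elim: r => // r IH; rewrite (leq_ltn_trans IH).
have stable r d i : (i < M r)%N -> s (r + d)%N i = s r i.
  move=> iM; elim: d => [|d <-]; first by rewrite addn0.
  rewrite addnS sM// (leq_trans iM)//; elim: d => [|d]; first by rewrite addn0.
  by move=> /leq_trans; apply; rewrite addnS ltnW.
pose x n := s n.+1 n.
have xE n r : x n = s (r + n.+1)%N n by rewrite addnC stable.
(* The telescoped geometric sum, kept exact so that the induction on [d] closes. *)
have dist r d n :
    normc (s (r + d)%N n - s r n) <= 2 * 2^-1 ^+ r - 2 * 2^-1 ^+ (r + d).
  elim: d => [|d IH]; first by rewrite addn0 !subrr normc0.
  rewrite -[X in normc (X - _)](subrK (s (r + d)%N n)) -addrA.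
  rewrite (le_trans (ler_normcD _ _))//.
  by rewrite addnS; have := sdist (r + d)%N n; rewrite exprS; lra.
have xdist r n : normc (x n - s r n) <= 2 * 2^-1 ^+ r.
  rewrite (xE n r) (le_trans (dist _ _ _))// lerBlDr lerDl.
  by rewrite mulr_ge0// exprn_ge0// invr_ge0.
have xb : x \in bounded_seq (R := R).
  apply/bounded_seqP; exists (2 + linfty_norm (s 0%N)) => n.
  rewrite -[x n](subrK (s 0%N n)) (le_trans (ler_normcD _ _))// lerD//.
    by have := xdist 0%N n; rewrite expr0 mulr1.
  exact: linfty_norm_ub.
exists (Linfty xb); split=> // r i iM /=.
by rewrite (xE i r) stable.
Qed.

Lemma infinite_zeros (R : realType) (x : linfty R) :
  (forall N, exists2 n, (N <= n)%N & x n = 0) -> ~ Z_linfty R x.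
Proof.
move=> xz /finite_seqP[l lE]; have [n ln xn] := xz (\max_(i <- l) i).+1.
have nl : n \in l.
  by have : [set n | x n = 0] n by []; rewrite lE.
by move: ln; rewrite ltnNge (@leq_bigmax_seq _ _ xpredT id).
Qed.

Theorem corollary4p8 (R : realType) : ~ spaceable (Z_linfty R).
Proof.
move=> [Y [Ysub Ycl Yinf YZ]].
have [y /choice[p yP]] := choice (infinite_dimensional_hump Ysub Yinf).
have [F [UF Foo]] := @ultraFilterLemma _ \oo eventually_filter.
have [z [k [[Yz z0 _ _] [zk _]]]] :=
  null_hump Ysub yP UF Foo 0 filterT.
pose good (s : linfty R) := Y s /\ null p F s.
(* The state is the current element [s] together with the bound [M] below which its
   coordinates are frozen; a step creates its zero at the new [M.-1]. *)
have /choice[step stepP] (c : nat * (linfty R * nat)) :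
    exists d : linfty R * nat, good c.2.1 ->
      [/\ good d.1, (c.2.2 < d.2)%N, d.1 d.2.-1 = 0,
        forall i, (i < c.2.2)%N -> d.1 i = c.2.1 i &
        forall n, normc (d.1 n - c.2.1 n) <= 2^-1 ^+ c.1].
  case: c => r [s M] /=.
  have [[Ys s0]|] := pselect (good s); last by exists (0, 0%N).
  have e0 : 0 < 2^-1 ^+ r :> R by rewrite exprn_gt0// invr_gt0.
  have [s' [q [[Ys' s'0 s'q Mq s'M] s's]]] :=
    null_correction Ysub yP UF Foo M e0 Ys s0.
  by exists (s', q.+1) => _; split.
(* The coordinate [p k] of [z], at least 1/2 in modulus, is frozen from the start;
   it keeps the limit away from [0]. *)
pose S := fix S r := if r is r'.+1 then step (r', S r') else (z, (p k).+1).
have Sgood r : good (S r).1.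
  by elim: r => [//|r IH]; have [] := stepP (r, S r) IH.
have Sstep r := stepP (r, S r) (Sgood r).
have [||| x [xS xdist]] := @linfty_gluing R (fun r => (S r).1) (fun r => (S r).2).
- by move=> r; have [] := Sstep r.
- by move=> r; have [] := Sstep r.
- by move=> r; have [] := Sstep r.
have Yx : Y x.
  apply: closed_uniform_approx => // e e0.
  have [r re] : exists r, 2 * 2^-1 ^+ r <= e.
    exists (Num.bound (2 / e)); rewrite exprVn ler_pdivrMr ?exprn_gt0//.
    by rewrite mulrC -ler_pdivrMr// ltW// upper_nthrootP.
  exists (S r).1; first by have [] := Sgood r.
  by move=> n; rewrite (le_trans (xdist r n)).
have le_S r : (r < (S r).2)%N.
  elim: r => // r IH; have [_ Sr _ _ _] := Sstep r.
  exact: leq_ltn_trans IH Sr.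
have [xZ|x0] := YZ _ Yx.
  apply: infinite_zeros xZ => N; exists (S N.+1).2.-1.
    by have := le_S N.+1; case: (S _).2 => //= n /ltnW.
  rewrite (xS N.+1); first by have [] := Sstep N.
  by have := le_S N.+1; case: (S _).2.
have := xS 0%N (p k) (leqnn _); rewrite x0 /= => zk0.
by move: zk; rewrite -zk0 normc0 leNgt invr_gt0 ltr0n.
Qed.
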